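(* The Gromov--Hausdorff distance $d_{GH}$ on the class $\mathcal{GH}$ of all metric spaces considered up to isometry is an intrinsic extended pseudometric: it satisfies the triangle inequality, and for all $X,Y\in\mathcal{GH}$ with $d_{GH}(X,Y)<\infty$ the value $d_{GH}(X,Y)$ equals the infimum of the lengths of continuous curves in $\mathcal{GH}$ connecting $X$ and $Y$. On the class $\mathcal B$ of all bounded metric spaces considered up to isometry, $d_{GH}$ is an intrinsic finite pseudometric: $d_{GH}$ takes only finite values on $\mathcal B$, satisfies the triangle inequality, and for all $X,Y\in\mathcal B$ the value $d_{GH}(X,Y)$ equals the infimum of the lengths of continuous curves in $\mathcal B$ connecting $X$ and $Y$.
   Context: All metric spaces are non-empty, with finite distances. For metric spaces $X,Y$, a correspondence is a subset $R\subset X\times Y$ that projects surjectively onto both $X$ and $Y$; its distortion is $\operatorname{dis}R=\sup\{\bigl||xx'|-|yy'|\bigr|:(x,y),(x',y')\in R\}$. The Gromov--Hausdorff distance $d_{GH}(X,Y)\in[0,\infty]$ is the infimum of $r$ such that $X$ and $Y$ can be isometrically embedded in a common metric space with Hausdorff distance between the images at most $r$; equivalently, $d_{GH}(X,Y)=\frac12\inf\operatorname{dis}R$ over all correspondences $R$ between $X$ and $Y$. Let $\mathcal{GH}$ be the (proper) class of all metric spaces up to isometry and $\mathcal B$ the subclass of bounded ones. An extended pseudometric is a symmetric function with values in $[0,\infty]$, vanishing on coinciding pairs and satisfying the triangle inequality. For a cardinal $n$, let $\mathcal{GH}_n$ (resp. $\mathcal B_n$) be the set of those elements of $\mathcal{GH}$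 (resp. $\mathcal B$) of cardinality at most $n$, with the topology generated by the open balls of $d_{GH}$. A continuous curve in $\mathcal{GH}$ (resp. $\mathcal B$) is a map from a segment $[a,b]\subset\mathbb R$ whose image lies in some $\mathcal{GH}_n$ (resp. $\mathcal B_n$) and which is continuous as a map to it. Its length is the supremum of sums of consecutive $d_{GH}$-distances over finite subdivisions of $[a,b]$. *)

(* Defs.v *)
From HB Require Import structures.
From mathcomp Require Import all_boot all_order all_algebra generic_quotient.
From mathcomp Require Import all_classical all_reals all_analysis.
Import Order.TTheory GRing.Theory Num.Theory.
Import numFieldNormedType.Exports.

Set Implicit Arguments.
Unset Strict Implicit.
Unset Printing Implicit Defensive.

Local Open Scope classical_set_scope.
Local Open Scope ring_scope.
Local Open Scope quotient_scope.

Section MetricPreliminaries.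
Variable R : realType.
Implicit Types X Y Z : metricType R.

Definition distance_preserving X Y (f : X -> Y) : Prop :=
  forall x x', mdist (f x) (f x') = mdist x x'.

Definition isometric X Y : Prop :=
  exists2 f : X -> Y, distance_preserving f & bijective f.

Definition bounded_metric X : Prop :=
  exists M : R, forall x x' : X, mdist x x' <= M.

Definition hausdorff_distance Z (A B : set Z) : \bar R :=
  maxe (ereal_sup [set ereal_inf [set (mdist a b)%:E | b in B] | a in A])
       (ereal_sup [set ereal_inf [set (mdist a b)%:E | a in A] | b in B]).

Definition gromov_hausdorff X Y : \bar R :=
  ereal_inf [set r%:E | r in [set r : R |
    exists (Z : metricType R) (f : X -> Z) (g : Y -> Z),
      [/\ distance_preserving f, distance_preserving g &
          (hausdorff_distance (range f) (range g) <= r%:E)%E]]].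

Lemma isometric_refl X : isometric X X.
Proof. by exists id => //; exists id. Qed.

Lemma isometric_sym X Y : isometric X Y -> isometric Y X.
Proof.
move=> [f fi [g fK gK]]; exists g; last by exists f.
by move=> y y'; rewrite -fi !gK.
Qed.

Lemma isometric_trans X Y Z : isometric X Y -> isometric Y Z -> isometric X Z.
Proof.
move=> [f fi fb] [g gi gb]; exists (g \o f); last exact: bij_comp.
by move=> x x'; rewrite /= gi fi.
Qed.

Lemma hausdorff_distance_sym Z (A B : set Z) :
  hausdorff_distance A B = hausdorff_distance B A.
Proof.
have E (S T : set Z) :
    [set ereal_inf [set (mdist a b)%:E | a in S] | b in T] =
    [set ereal_inf [set (mdist b a)%:E | a in S] | b in T].
  apply: eq_imagel => b _; congr ereal_inf.
  by apply: eq_imagel => a _; rewrite metric_sym.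
by rewrite /hausdorff_distance maxC E [in RHS]E.
Qed.

Lemma gromov_hausdorff_sym X Y : gromov_hausdorff X Y = gromov_hausdorff Y X.
Proof.
suff sub X' Y' r : (exists (Z : metricType R) (f : X' -> Z) (g : Y' -> Z),
      [/\ distance_preserving f, distance_preserving g &
          (hausdorff_distance (range f) (range g) <= r%:E)%E]) ->
    exists (Z : metricType R) (f : Y' -> Z) (g : X' -> Z),
      [/\ distance_preserving f, distance_preserving g &
          (hausdorff_distance (range f) (range g) <= r%:E)%E].
  by congr (ereal_inf (image _ _)); apply/seteqP; split=> r; exact: sub.
move=> [Z [f [g [fi gi fg]]]]; exists Z, g, f; split=> //.
by rewrite hausdorff_distance_sym.
Qed.

Lemma gromov_hausdorff_isometricl X X' Y :
  isometric X X' -> gromov_hausdorff X Y = gromov_hausdorff X' Y.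
Proof.
suff sub X1 X2 r : isometric X1 X2 ->
    (exists (Z : metricType R) (f : X1 -> Z) (g : Y -> Z),
      [/\ distance_preserving f, distance_preserving g &
          (hausdorff_distance (range f) (range g) <= r%:E)%E]) ->
    exists (Z : metricType R) (f : X2 -> Z) (g : Y -> Z),
      [/\ distance_preserving f, distance_preserving g &
          (hausdorff_distance (range f) (range g) <= r%:E)%E].
  move=> XX'; congr (ereal_inf (image _ _)); apply/seteqP; split=> r.
    exact: sub.
  by apply: sub; exact: isometric_sym.
move=> [h hi [k hK kK]] [Z [f [g [fi gi fg]]]]; exists Z, (f \o k), g; split=> //.
  by move=> x x'; rewrite /= fi -hi !kK.
suff -> : range (f \o k) = range f by [].
apply/seteqP; split=> z [x _ <-]; first by exists (k x).
by exists (h x); rewrite //= hK.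
Qed.

Lemma gromov_hausdorff_isometric X X' Y Y' :
  isometric X X' -> isometric Y Y' ->
  gromov_hausdorff X Y = gromov_hausdorff X' Y'.
Proof.
move=> XX' YY'; rewrite (gromov_hausdorff_isometricl _ XX') gromov_hausdorff_sym.
by rewrite (gromov_hausdorff_isometricl _ YY') gromov_hausdorff_sym.
Qed.

Lemma bounded_metric_isometric X X' :
  isometric X X' -> bounded_metric X -> bounded_metric X'.
Proof.
by move=> /isometric_sym[h hi _] [M XM]; exists M => x x'; rewrite -hi.
Qed.

Lemma card_le_isometric X X' (N : Type) : isometric X X' ->
  ([set: X] #<= [set: N])%card -> ([set: X'] #<= [set: N])%card.
Proof.
move=> /isometric_sym[h _ /bij_inj hI]; apply: card_le_trans.
have [f] : $|{injfun [set: X'] >-> [set: X]}|.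
  by apply/injfunPex; exists h => // x y _ _ /hI.
exact: inj_card_le f.
Qed.

End MetricPreliminaries.

(* The carriers range over a universe strictly below that of [metricType], so
   that the type of all spaces can itself carry a quotient and a topology. *)
Record mspace (R : realType) := MSpace {
  mspace_carrier : Type;
  mspace_class : Metric.axioms_ R mspace_carrier;
  mspace_nonempty : inhabited mspace_carrier }.

Coercion mspace_sort (R : realType) (X : mspace R) : metricType R :=
  Metric.Pack (mspace_class X).

HB.instance Definition _ (R : realType) := gen_eqMixin (mspace R).
HB.instance Definition _ (R : realType) := gen_choiceMixin (mspace R).

Section IsometryClasses.
Variable R : realType.

Definition isometric_rel : rel (mspace R) := fun X Y => `[< isometric X Y >].

Lemma isometric_rel_equiv : equiv_class_of isometric_rel.
Proof.
split.
- by move=> X; apply/asboolP; exact: isometric_refl.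
- by move=> X Y; apply/asboolP/asboolP; exact: isometric_sym.
- move=> Y X Z /asboolP XY /asboolP YZ; apply/asboolP.
  exact: isometric_trans XY YZ.
Qed.

Canonical isometric_equiv := EquivRelPack isometric_rel_equiv.

Definition GH := {eq_quot isometric_equiv}.

HB.instance Definition _ := Choice.on GH.
HB.instance Definition _ := EqQuotient.on GH.

Definition d_GH (X Y : GH) : \bar R := gromov_hausdorff (repr X : mspace R) (repr Y : mspace R).

Definition bounded_class : set GH := [set X : GH | bounded_metric (repr X : mspace R)].

(* The cardinal n is represented by a type [N] of that cardinality. *)
Definition card_class (N : Type) : set GH :=
  [set X : GH | ([set: (repr X : mspace R)] #<= [set: N])%card].

Lemma isometric_repr (X : mspace R) : isometric (repr (\pi_GH X)) X.
Proof.
have : \pi_GH (repr (\pi_GH X)) = \pi_GH X by rewrite reprK.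
by move=> /eqmodP /asboolP.
Qed.

Lemma d_GH_pi (X Y : mspace R) : d_GH (\pi_GH X) (\pi_GH Y) = gromov_hausdorff X Y.
Proof. exact: gromov_hausdorff_isometric (isometric_repr X) (isometric_repr Y). Qed.

Lemma bounded_class_pi (X : mspace R) :
  bounded_class (\pi_GH X) <-> bounded_metric X.
Proof.
split; apply: bounded_metric_isometric; first exact: isometric_repr.
exact/isometric_sym/isometric_repr.
Qed.

Lemma card_class_pi (X : mspace R) (N : Type) :
  card_class N (\pi_GH X) <-> ([set: X] #<= [set: N])%card.
Proof.
split; apply: card_le_isometric; first exact: isometric_repr.
exact/isometric_sym/isometric_repr.
Qed.

End IsometryClasses.

Section BoundedCardinality.
Variables (R : realType) (C : set (GH R)) (N : Type).

(* The set C_n of members of the class C of cardinality at most n = |N|. *)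
Record subclass := Subclass {
  subclass_val :> GH R;
  subclass_in : C subclass_val;
  subclass_card : card_class N subclass_val }.

HB.instance Definition _ := gen_eqMixin subclass.
HB.instance Definition _ := gen_choiceMixin subclass.

Definition open_ball_GH (X : subclass) (r : R) : set subclass :=
  [set Y | (d_GH X Y < r%:E)%E].

HB.instance Definition _ := @isSubBaseTopological.Build subclass
  (set subclass) [set open_ball_GH X r | X in setT & r in [set r | 0 < r]] id.

End BoundedCardinality.

Section Intrinsic.
Variable R : realType.

Definition curve_length (a b : R) (g : R -> GH R) : \bar R :=
  ereal_sup [set (\sum_(0 <= i < size s)
      d_GH (g (nth b (a :: s) i)) (g (nth b (a :: s) i.+1)))%E
    | s in itv_partition a b].

Definition connecting_lengths (C : set (GH R)) (X Y : GH R) : set (\bar R) :=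
  [set l | exists (N : Type) (a b : R) (g : R -> subclass C N),
    [/\ a <= b, {within `[a, b], continuous g},
        g a = X :> GH R, g b = Y :> GH R & l = curve_length a b g]].

Definition extended_pseudometric_on (C : set (GH R)) (d : GH R -> GH R -> \bar R)
    : Prop :=
  [/\ (forall X Y, C X -> C Y -> (0 <= d X Y)%E),
      (forall X, C X -> d X X = 0%E),
      (forall X Y, C X -> C Y -> d X Y = d Y X) &
      (forall X Y Z, C X -> C Y -> C Z -> (d X Z <= d X Y + d Y Z)%E)].

End Intrinsic.

(* Main.v *)
(* A bound d_GH(X, Y) < r provides a correspondence P of distortion at most 2r,
   and conversely such a P gives d_GH(X, Y) <= r by gluing X and Y along P with
   related points at distance r.  Composing correspondences yields the triangle
   inequality.  For 0 < t < 1 the set P itself, with the metric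
   (1 - t) d_X + t d_Y, is a metric space; together with X at t = 0 and Y at
   t = 1 these spaces form an r-Lipschitz curve, hence one of length at most r,
   and all of them have cardinality at most |P|.  The curve stays at finite
   distance from X, hence in B if X is bounded. *)
From HB Require Import structures.
Require Import Defs.
From mathcomp Require Import all_boot all_order all_algebra generic_quotient.
From mathcomp Require Import all_classical all_reals all_analysis.
From mathcomp Require Import lra.
Import Order.TTheory GRing.Theory Num.Theory.
Import numFieldNormedType.Exports.

Set Implicit Arguments.
Unset Strict Implicit.
Unset Printing Implicit Defensive.

Local Open Scope classical_set_scope.
Local Open Scope ring_scope.
Local Open Scope quotient_scope.

(** * Metric spaces from explicit distance functions *)

Section MetricOfDistance.
Variable R : realType.

Record is_distance (T : Type) (d : T -> T -> R) : Prop := IsDistance {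
  distxx : forall x, d x x = 0;
  dist_pos : forall x y, d x y = 0 -> x = y;
  dist_sym : forall x y, d x y = d y x;
  dist_tri : forall y x z, d x z <= d x y + d y z }.

(** An alias indexed by the proof, so that one type can carry several metrics. *)
Definition metrized T (d : T -> T -> R) of is_distance d : Type := T.

Section Instance.
Variables (T : Type) (d : T -> T -> R) (dP : is_distance d).
HB.instance Definition _ := gen_eqMixin (metrized dP).
HB.instance Definition _ := gen_choiceMixin (metrized dP).
HB.instance Definition _ := @isMetric.Build R (metrized dP) d
  (distxx dP) (dist_pos dP) (dist_sym dP) (dist_tri dP).
End Instance.

End MetricOfDistance.

(** * Correspondences and the Gromov--Hausdorff distance *)

Section Correspondences.
Variable R : realType.
Implicit Types X Y Z : metricType R.

Definition correspondence (X Y : Type) (P : X -> Y -> Prop) :=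
  (forall x, exists y, P x y) /\ (forall y, exists x, P x y).

Definition distortion_le X Y (P : X -> Y -> Prop) (e : R) :=
  forall x x' y y', P x y -> P x' y' -> `|mdist x x' - mdist y y'| <= e.

Lemma gromov_hausdorff_lt_correspondence X Y (r : R) :
  (gromov_hausdorff X Y < r%:E)%E ->
  exists2 P : X -> Y -> Prop, correspondence P & distortion_le P (2 * r).
Proof.
move=> /ereal_inf_lt[_ [s [Z [f [g [fi gi +]]]] <-]]; rewrite lte_fin.
rewrite /hausdorff_distance ge_max => /andP[fg gf] sr.
(* The infima in the Hausdorff distance need not be attained; the gap [s < r] still yields a partner
   for every point. *)
exists (fun x y => mdist (f x) (g y) < r).
  split=> [x|y].
  - have : (ereal_inf [set (mdist (f x) b)%:E | b in range g] < r%:E)%E.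
      apply: le_lt_trans (_ : (s%:E < r%:E)%E); last by rewrite lte_fin.
      apply: le_trans fg; apply: ereal_sup_ubound => /=.
      by exists (f x) => //; exists x.
    by move=> /ereal_inf_lt[_ [_ [y _ <-] <-]]; rewrite lte_fin; exists y.
  - have : (ereal_inf [set (mdist a (g y))%:E | a in range f] < r%:E)%E.
      apply: le_lt_trans (_ : (s%:E < r%:E)%E); last by rewrite lte_fin.
      apply: le_trans gf; apply: ereal_sup_ubound => /=.
      by exists (g y) => //; exists y.
    by move=> /ereal_inf_lt[_ [_ [x _ <-] <-]]; rewrite lte_fin; exists x.
move=> x x' y y' xy xy'; rewrite -fi -gi ler_norml.
have := metric_triangle (f x) (g y) (f x').
have := metric_triangle (g y) (g y') (f x').
have := metric_triangle (g y) (f x) (g y').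
have := metric_triangle (f x) (f x') (g y').
rewrite (metric_sym (g y) (f x)) (metric_sym (g y') (f x')).
move=> *; apply/andP; split; lra.
Qed.

(** * Gluing two spaces along a correspondence *)

Section Gluing.
Variables (X Y : metricType R) (P : X -> Y -> Prop) (r : R).

Definition cross_lengths (x : X) (y : Y) : set R :=
  [set u | exists a b, P a b /\ u = mdist x a + r + mdist b y].

(** Infimum of the lengths of paths from [x] to [y] through one related pair, the crossing costing
    [r]. *)
Definition cross_dist x y : R := inf (cross_lengths x y).

Definition glue_dist (z w : X + Y) : R :=
  match z, w with
  | inl x, inl x' => mdist x x'
  | inr y, inr y' => mdist y y'
  | inl x, inr y | inr y, inl x => cross_dist x y
  end.

Hypotheses (r_gt0 : 0 < r) (PC : correspondence P).
Hypothesis Pr : distortion_le P (2 * r).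

Lemma cross_lengths_neq0 x y : cross_lengths x y !=set0.
Proof. by have [b ab] := PC.1 x; exists (mdist x x + r + mdist b y), x, b. Qed.

Lemma cross_dist_le x y a b :
  P a b -> cross_dist x y <= mdist x a + r + mdist b y.
Proof.
move=> ab; apply: ge_inf; last by exists a, b.
by exists 0 => _ [a' [b' [_ ->]]]; rewrite !addr_ge0 ?mdist_ge0 ?ltW.
Qed.

Lemma le_cross_dist x y u :
  (forall a b, P a b -> u <= mdist x a + r + mdist b y) -> u <= cross_dist x y.
Proof.
move=> H; apply: lb_le_inf; first exact: cross_lengths_neq0.
by move=> _ [a [b [ab ->]]]; exact: H.
Qed.

Lemma cross_dist_gt0 x y : 0 < cross_dist x y.
Proof.
apply: lt_le_trans r_gt0 _; apply: le_cross_dist => a b _.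
by have := mdist_ge0 x a; have := mdist_ge0 b y; lra.
Qed.

Lemma glue_distP : is_distance glue_dist.
Proof.
split.
- by case=> x /=; rewrite mdistxx.
- by case=> x [] y //=; [move=> /mdist_positivity-> | have := cross_dist_gt0 x y
    | have := cross_dist_gt0 y x | move=> /mdist_positivity->];
    rewrite // lt_neqAle eq_sym => /andP[/eqP].
- by case=> x [] y //=; rewrite metric_sym.
have slideX x x' y : cross_dist x y <= mdist x x' + cross_dist x' y.
  rewrite -lerBlDl; apply: le_cross_dist => a b ab.
  by have := cross_dist_le x y ab; have := metric_triangle x x' a; lra.
have slideY x y y' : cross_dist x y <= cross_dist x y' + mdist y' y.
  rewrite -lerBlDr; apply: le_cross_dist => a b ab.
  by have := cross_dist_le x y ab; have := metric_triangle b y' y; lra.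
(* Going across and back costs [2 * r], which is exactly what the distortion bound [Pr] allows. *)
have crossX x x' y : mdist x x' <= cross_dist x y + cross_dist x' y.
  rewrite -lerBlDr; apply: le_cross_dist => a b ab.
  rewrite lerBlDr -lerBlDl; apply: le_cross_dist => a' b' ab'.
  have := Pr ab ab'; rewrite ler_norml => /andP[_].
  have := metric_triangle x a x'; have := metric_triangle a a' x'.
  have := metric_triangle b y b'.
  by rewrite (metric_sym a' x') (metric_sym y b'); lra.
have crossY x y y' : mdist y y' <= cross_dist x y + cross_dist x y'.
  rewrite -lerBlDr; apply: le_cross_dist => a b ab.
  rewrite lerBlDr -lerBlDl; apply: le_cross_dist => a' b' ab'.
  have := Pr ab ab'; rewrite ler_norml => /andP[+ _].
  have := metric_triangle y b y'; have := metric_triangle b b' y'.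
  have := metric_triangle a x a'.
  by rewrite (metric_sym y b) (metric_sym a x); lra.
(* The four facts above close four of the eight cases; two of the others are mirror images of
   [slideX] and [slideY]. *)
case=> y [] x [] z //=.
- exact: metric_triangle.
- by rewrite metric_sym addrC slideX.
- by rewrite addrC metric_sym slideY.
- exact: metric_triangle.
Qed.

End Gluing.

Lemma gromov_hausdorff_le_gt0 X Y (P : X -> Y -> Prop) (r : R) : 0 < r ->
  correspondence P -> distortion_le P (2 * r) -> (gromov_hausdorff X Y <= r%:E)%E.
Proof.
move=> r_gt0 PC Pr; apply: ereal_inf_lbound; exists r => //.
pose dP := glue_distP r_gt0 PC Pr.
exists (metrized dP : metricType R), inl, inr; split=> //.
have le_r x y : P x y -> cross_dist P r x y <= r.
  by move=> /(cross_dist_le r_gt0 x y); rewrite !mdistxx add0r addr0.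
rewrite /hausdorff_distance ge_max; apply/andP; split.
- apply: ge_ereal_sup => _ [_ [x _ <-] <-].
  have [y xy] := PC.1 x; apply: ereal_inf_le.
  exists (cross_dist P r x y)%:E; last by rewrite lee_fin le_r.
  by exists (inr y) => //; exists y.
- apply: ge_ereal_sup => _ [_ [y _ <-] <-].
  have [x xy] := PC.2 y; apply: ereal_inf_le.
  exists (cross_dist P r x y)%:E; last by rewrite lee_fin le_r.
  by exists (inl x) => //; exists x.
Qed.

(** At [r = 0] the glued distance fails to separate related points, so the bound is obtained for
    [r + e] and [e] tends to 0. *)
Lemma gromov_hausdorff_le X Y (P : X -> Y -> Prop) (r : R) : 0 <= r ->
  correspondence P -> distortion_le P (2 * r) -> (gromov_hausdorff X Y <= r%:E)%E.
Proof.
move=> r_ge0 PC Pr; apply/lee_addgt0Pr => e e_gt0; rewrite -EFinD.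
apply: (@gromov_hausdorff_le_gt0 _ _ P) => // [|x x' y y' xy xy'].
  by rewrite ltr_wpDl.
by apply: le_trans (Pr _ _ _ _ xy xy') _; lra.
Qed.

End Correspondences.

(** * Pseudometric axioms for spaces *)

Section GromovHausdorffPseudometric.
Variable R : realType.
Implicit Types X Y Z : mspace R.

(** Non-emptiness provides a related pair; compared with itself it gives [0 <= 2 * r]. *)
Lemma gromov_hausdorff_lt_ge0 X Y (r : R) :
  (gromov_hausdorff X Y < r%:E)%E -> 0 <= r.
Proof.
move=> /gromov_hausdorff_lt_correspondence[P [PX _] Pr].
have [x] := mspace_nonempty X; have [y xy] := PX x.
by have := Pr _ _ _ _ xy xy; rewrite !mdistxx subrr normr0 pmulr_rge0.
Qed.

Lemma gromov_hausdorff_ge0 X Y : (0 <= gromov_hausdorff X Y)%E.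
Proof.
have := @gromov_hausdorff_lt_ge0 X Y.
case: (gromov_hausdorff X Y) => [s| |] H; rewrite ?leey//.
- rewrite lee_fin leNgt; apply/negP => s0.
  (* For [s < 0], the number [s / 2] is still negative but lies strictly above [s]. *)
  have : 0 <= s / 2 by apply: H; rewrite lte_fin; lra.
  by lra.
- by have := H (-1) (ltNyr _); rewrite lerNr oppr0 ler10.
Qed.

Lemma gromov_hausdorff_xx X : gromov_hausdorff X X = 0%E.
Proof.
apply/eqP; rewrite eq_le gromov_hausdorff_ge0 andbT.
apply: (@gromov_hausdorff_le _ _ _ eq) => //.
  by split=> x; exists x.
by move=> x x' _ _ <- <-; rewrite subrr normr0 mulr0.
Qed.

Lemma gromov_hausdorff_triangle X Y Z :
  (gromov_hausdorff X Z <= gromov_hausdorff X Y + gromov_hausdorff Y Z)%E.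
Proof.
have := gromov_hausdorff_ge0 X Y; have := gromov_hausdorff_ge0 Y Z.
have := @gromov_hausdorff_lt_correspondence _ X Y.
have := @gromov_hausdorff_lt_correspondence _ Y Z.
case: (gromov_hausdorff X Y) => [u| |]//; case: (gromov_hausdorff Y Z) => [v| |]//;
  rewrite ?leey// => HYZ HXY; rewrite !lee_fin => v0 u0.
rewrite -EFinD; apply/lee_addgt0Pr => e e0; rewrite -EFinD.
(* Slack [e / 2] on each side makes the distortions add up to [2 * (u + v + e)]. *)
have [|P [PX PY] Pr] := HXY (u + e / 2); first by rewrite lte_fin ltrDl divr_gt0.
have [|Q [QY QZ] Qr] := HYZ (v + e / 2); first by rewrite lte_fin ltrDl divr_gt0.
apply: (@gromov_hausdorff_le _ _ _ (fun x z => exists2 y, P x y & Q y z)).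
- by rewrite !addr_ge0 // ltW.
- split=> [x|z].
  + by have [y xy] := PX x; have [z yz] := QY y; exists z, y.
  + by have [y yz] := QZ z; have [x xy] := PY y; exists x, y.
- move=> x x' z z' [y xy yz] [y' xy' yz'].
  rewrite (le_trans (ler_distD (mdist y y') _ _))//.
  by have := Pr _ _ _ _ xy xy'; have := Qr _ _ _ _ yz yz'; lra.
Qed.

End GromovHausdorffPseudometric.

(** * Isometry classes: finiteness, boundedness, continuity *)

Section Classes.
Variable R : realType.
Implicit Types X Y Z : GH R.

Lemma d_GH_ge0 X Y : (0 <= d_GH X Y)%E.
Proof. exact: gromov_hausdorff_ge0. Qed.

Lemma d_GH_sym X Y : d_GH X Y = d_GH Y X.
Proof. exact: gromov_hausdorff_sym. Qed.

Lemma d_GH_triangle Y X Z : (d_GH X Z <= d_GH X Y + d_GH Y Z)%E.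
Proof. exact: gromov_hausdorff_triangle. Qed.

Lemma extended_pseudometric_d_GH (C : set (GH R)) :
  extended_pseudometric_on C (@d_GH R).
Proof.
split=> *; [exact: d_GH_ge0 | exact: gromov_hausdorff_xx | exact: d_GH_sym |
  exact: d_GH_triangle].
Qed.

Lemma bounded_class_d_GH_fin X Y :
  bounded_class X -> bounded_class Y -> d_GH X Y \is a fin_num.
Proof.
move=> [M XM] [L YL]; rewrite ge0_fin_numE ?d_GH_ge0//.
have [x] := mspace_nonempty (repr X); have [y] := mspace_nonempty (repr Y).
have M0 : 0 <= M := le_trans (mdist_ge0 (x : repr X) x) (XM x x).
have L0 : 0 <= L := le_trans (mdist_ge0 (y : repr Y) y) (YL y y).
apply: (@le_lt_trans _ _ (M + L)%:E); last exact: ltry.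
(* All distances lie in [[0, M]] or [[0, L]], so even the full relation has finite distortion. *)
apply: (@gromov_hausdorff_le _ _ _ (fun _ _ => True)).
- exact: addr_ge0.
- by split=> _; [exists y | exists x].
- move=> a a' b b' _ _; rewrite ler_norml.
  have := XM a a'; have := YL b b'.
  have := mdist_ge0 a a'; have := mdist_ge0 b b'.
  by move=> *; apply/andP; split; lra.
Qed.

Lemma d_GH_ltyP X Y : (d_GH X Y < +oo)%E -> exists r, (d_GH X Y < r%:E)%E.
Proof.
have := d_GH_ge0 X Y; case: (d_GH X Y) => // u _ _.
by exists (u + 1); rewrite lte_fin ltrDl.
Qed.

(** A correspondence of distortion at most [2 * r] turns the bound [M] into [M + 2 * r]. This keeps
    curves issuing from a bounded space inside the bounded class. *)
Lemma bounded_class_d_GH_closed X Y :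
  bounded_class X -> (d_GH X Y < +oo)%E -> bounded_class Y.
Proof.
move=> [M XM] /d_GH_ltyP[r /gromov_hausdorff_lt_correspondence[P [_ PY] Pr]].
exists (M + 2 * r) => y y'; have [x xy] := PY y; have [x' xy'] := PY y'.
have := Pr _ _ _ _ xy xy'; rewrite ler_norml => /andP[+ _].
by have := XM x x'; lra.
Qed.

Lemma continuous_subclass (C : set (GH R)) (N : Type) (T : topologicalType)
    (f : T -> subclass C N) :
  (forall t (e : R), 0 < e -> \forall s \near t, (d_GH (f t) (f s) < e%:E)%E) ->
  continuous f.
Proof.
move=> H t A; rewrite nbhsE => -[B [oB Bt] BA].
apply: (@filterS _ (nbhs t) _ (f @^-1` B)); first by move=> s /BA.
case: oB Bt => D' sD' <- [U D'U Ut].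
apply: (@filterS _ (nbhs t) _ (f @^-1` U)); first by move=> s Us; exists U.
have [F FD UE] := sD' _ D'U; rewrite -UE in Ut *.
apply: filter_bigI => V VF; have := FD _ VF; rewrite inE => -[Z _ [r _ VE]].
have : (d_GH Z (f t) < r%:E)%E by move: (Ut V VF); rewrite -VE.
have := d_GH_ge0 Z (f t); case E : (d_GH Z (f t)) => [u| |]// _.
(* By the triangle inequality, the ball of radius [r - u] about [f t] lies in the subbasic ball of
   radius [r] about [Z]. *)
rewrite lte_fin -subr_gt0 => /(H t); apply: filterS => s fs /=.
rewrite -VE /open_ball_GH /=; apply: le_lt_trans (d_GH_triangle (f t) _ _) _.
by rewrite E -lteBrDl.
Qed.

End Classes.

(** * Interpolated metrics on a correspondence *)

Section Interpolation.
Variables (R : realType) (X Y : mspace R).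
(* Written with [mspace_carrier], not the coercion to [metricType], so that
   [graph_of] lives in the universe of carriers of [mspace]. *)
Variable P : mspace_carrier X -> mspace_carrier Y -> Prop.

Definition graph_of := {xy : mspace_carrier X * mspace_carrier Y | P xy.1 xy.2}.

Definition interpolated_dist (t : R) (k l : graph_of) : R :=
  (1 - t) * mdist ((sval k).1 : X) (sval l).1 +
  t * mdist ((sval k).2 : Y) (sval l).2.

(** Strictness gives separation: with both weights positive, a zero sum makes both coordinates
    agree. *)
Lemma interpolated_distP (t : R) : 0 < t < 1 -> is_distance (interpolated_dist t).
Proof.
rewrite /interpolated_dist => /andP[t0 t1]; have t1' : 0 < 1 - t by lra.
split.
- by move=> k; rewrite !mdistxx !mulr0 addr0.
- move=> [[x y] xy] [[x' y'] xy'] /= /eqP.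
  rewrite paddr_eq0 ?mulr_ge0 ?mdist_ge0// ?ltW//.
  rewrite !mulf_eq0 (gt_eqF t0) (gt_eqF t1') /= => /andP[/eqP + /eqP].
  move=> /mdist_positivity xx' /mdist_positivity yy'.
  by apply: eq_exist; rewrite xx' yy'.
- by move=> k l; rewrite metric_sym [in X in _ + X]metric_sym.
- move=> l k m; rewrite addrACA -!mulrDr lerD// ler_wpM2l ?metric_triangle ?ltW//.
Qed.

Hypothesis PC : correspondence P.

(* All spaces are parametrized by the same set [graph_of]; the endpoints are
   exactly [X] and [Y] since at [t = 0, 1] the interpolated distance degenerates. *)
Lemma interpolated_space (t : R) : 0 <= t <= 1 ->
  exists (A : mspace R) (p : graph_of -> A),
    [/\ forall a, exists k, p k = a,
        forall k l, mdist (p k) (p l) = interpolated_dist t k l,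
        t = 0 -> A = X & t = 1 -> A = Y].
Proof.
rewrite /interpolated_dist !le_eqVlt => /andP[/predU1P[<- _|t0]].
  exists X, (fun k => (sval k).1); split=> //.
  - by move=> x; have [y xy] := PC.1 x; exists (exist _ (x, y) xy).
  - by move=> k l; rewrite subr0 mul1r mul0r addr0.
  - by move=> /esym/eqP; rewrite oner_eq0.
move=> /predU1P[->|t1].
  exists Y, (fun k => (sval k).2); split=> //.
  - by move=> y; have [x xy] := PC.2 y; exists (exist _ (x, y) xy).
  - by move=> k l; rewrite subrr mul0r add0r mul1r.
  - by move=> /eqP; rewrite oner_eq0.
have t01 : 0 < t < 1 by rewrite t0 t1.
have [x] := mspace_nonempty X; have [y xy] := PC.1 x.
exists (@MSpace R graph_of (Metric.class (metrized (interpolated_distP t01)))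
  (inhabits (exist _ (x, y) xy))), id; split=> //.
- by move=> a; exists a.
- by move=> te; rewrite te ltxx in t0.
- by move=> te; rewrite te ltxx in t1.
Qed.

End Interpolation.

(** * Lipschitz curves of spaces *)

Section Geodesics.
Variable R : realType.

(** Curves are functions on all of [R]; this 1-Lipschitz retraction onto [[0, 1]] extends them by
    constants. *)
Definition clamp (t : R) : R := if t < 0 then 0 else if t < 1 then t else 1.

Lemma clamp_itv t : 0 <= clamp t <= 1.
Proof.
by rewrite /clamp; case: (ltP t 0); case: (ltP t 1) => *; apply/andP; split; lra.
Qed.

Lemma clamp_id t : 0 <= t <= 1 -> clamp t = t.
Proof.
by rewrite /clamp; case: (ltP t 0); case: (ltP t 1) => ? ? /andP[]; lra.
Qed.

Lemma clamp_lipschitz s t : `|clamp s - clamp t| <= `|s - t|.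
Proof.
rewrite /clamp; case: (ltP s 0); case: (ltP s 1); case: (ltP t 0);
  case: (ltP t 1) => *; rewrite ler_norml; case: (lerP s t) => *;
  apply/andP; split; lra.
Qed.

(** Every space of the curve is an image of [graph_of P]. This bounds all cardinalities at once, and
    matching images of the same point relates any two of the spaces. *)
Lemma lipschitz_curve (X Y : GH R) (r : R) : (d_GH X Y < r%:E)%E ->
  exists (N : Type) (g : R -> GH R),
    [/\ forall t, card_class N (g t),
        forall s t, (d_GH (g s) (g t) <= (r * `|s - t|)%:E)%E,
        g 0 = X & g 1 = Y].
Proof.
move=> XYr; have r0 := gromov_hausdorff_lt_ge0 XYr.
have [P PC Pr] := gromov_hausdorff_lt_correspondence XYr.
have [A HA] := choice (fun t => interpolated_space PC (clamp_itv t)).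
exists (graph_of P), (fun t => \pi_(GH R) (A t)); split.
- move=> t; apply/card_class_pi; have [p [psurj _ _ _]] := HA t.
  rewrite (_ : [set: A t] = range p) ?card_image_le//.
  by apply/seteqP; split=> // a _; have [k <-] := psurj a; exists k.
- move=> s t; rewrite d_GH_pi.
  have [p [psurj pd _ _]] := HA s; have [q [qsurj qd _ _]] := HA t.
  apply: (@gromov_hausdorff_le _ _ _ (fun a b => exists2 k, p k = a & q k = b)).
  + by rewrite mulr_ge0.
  + split=> [a|b].
      by have [k <-] := psurj a; exists (q k), k.
    by have [k <-] := qsurj b; exists (p k), k.
  + move=> _ _ _ _ [k <- <-] [l <- <-]; rewrite pd qd /interpolated_dist.
    set a := mdist _ _; set b := mdist _ _.
    (* The interpolated distance is affine in the parameter, with slope [b - a] bounded by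
       [2 * r]. *)
    rewrite (_ : _ - _ = (clamp s - clamp t) * (b - a)); last by lra.
    rewrite normrM mulrA mulrC ler_pM// ?clamp_lipschitz//.
    by rewrite distrC; apply: Pr; [exact: (svalP k) | exact: (svalP l)].
- have [_ [_ _ A0 _]] := HA 0.
  by rewrite A0 ?reprK// clamp_id// lexx ler01.
- have [_ [_ _ _ A1]] := HA 1.
  by rewrite A1 ?reprK// clamp_id// lexx ler01.
Qed.

End Geodesics.


(** * Curve lengths and intrinsicness *)

Section Intrinsic.
Variable R : realType.
Implicit Types X Y : GH R.

Lemma d_GH_le_curve_length (a b : R) (g : R -> GH R) :
  a <= b -> (d_GH (g a) (g b) <= curve_length a b g)%E.
Proof.
(* Partitions list their points without the left end: [[::]] serves when the ends coincide, [[:: b]]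
   otherwise. *)
rewrite le_eqVlt => /predU1P[->|ab]; apply: ereal_sup_ubound => /=.
  exists [::]; first by rewrite /itv_partition.
  by rewrite big_nil [RHS]gromov_hausdorff_xx.
by exists [:: b]; [exact: itv_partition1 | rewrite big_nat1].
Qed.

Lemma lipschitz_curve_length (a b r : R) (g : R -> GH R) :
  (forall s t, d_GH (g s) (g t) <= (r * `|s - t|)%:E)%E ->
  (curve_length a b g <= (r * (b - a))%:E)%E.
Proof.
move=> gr; apply: ge_ereal_sup => _ [s sP <-].
elim: s a sP => [a /itv_partition_nil ->|x s ih a].
  by rewrite big_nil subrr mulr0.
move=> /[dup] /itv_partition_cons xs [/= /andP[ax _] _].
rewrite big_nat_recl//= (_ : r * (b - a) = r * `|a - x| + r * (b - x)).
  by rewrite EFinD leeD ?ih.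
by rewrite distrC gtr0_norm ?subr_gt0//; lra.
Qed.

(** Stated for any class containing all spaces at finite distance from [X], so as to cover both the
    full class and the bounded one. *)
Lemma d_GH_intrinsic (C : set (GH R)) X Y :
  (forall Z, (d_GH X Z < +oo)%E -> C Z) -> (d_GH X Y < +oo)%E ->
  d_GH X Y = ereal_inf (connecting_lengths C X Y).
Proof.
move=> CX XY; apply/eqP; rewrite eq_le; apply/andP; split.
  apply: le_ereal_inf_tmp => _ [N [a [b [g [ab _ <- <- ->]]]]].
  exact: (d_GH_le_curve_length (fun t => g t)).
have : d_GH X Y \is a fin_num by rewrite ge0_fin_numE ?d_GH_ge0.
move=> /fineK; set u := fine _ => uE; rewrite -uE; apply/lee_addgt0Pr => e e0.
have [|N [g [gN gr g0 g1]]] := @lipschitz_curve _ X Y (u + e).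
  by rewrite -uE lte_fin ltrDl.
have gC t : C (g t).
  by apply: CX; rewrite -g0; apply: le_lt_trans (gr _ _) (ltry _).
rewrite -EFinD; apply: ereal_inf_le.
exists (curve_length 0 1 g); last first.
  by have := lipschitz_curve_length 0 1 gr; rewrite subr0 mulr1.
exists N, 0, 1, (fun t => Subclass (gC t) (gN t)); split=> //.
apply: continuous_subspaceT; apply: continuous_subclass => t d d0 /=.
have ud : 0 < u + e.
  by apply: ltr_wpDl => //; rewrite -lee_fin uE d_GH_ge0.
(* A curve with Lipschitz constant [u + e] moves by less than [d] within this radius. *)
have : \forall s \near t, `|t - s| < d / (u + e).
  by exact: nbhsx_ballx (divr_gt0 d0 ud).
apply: filterS => s; rewrite ltr_pdivlMr// mulrC => ts.
by apply: le_lt_trans (gr _ _) _; rewrite lte_fin.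
Qed.

End Intrinsic.

Theorem corollary2p2 (R : realType) :
  (extended_pseudometric_on [set: GH R] (@d_GH R) /\
   forall X Y : GH R, (d_GH X Y < +oo)%E ->
     d_GH X Y = ereal_inf (connecting_lengths [set: GH R] X Y)) /\
  [/\ forall X Y : GH R, bounded_class X -> bounded_class Y ->
        d_GH X Y \is a fin_num,
      extended_pseudometric_on (@bounded_class R) (@d_GH R) &
      forall X Y : GH R, bounded_class X -> bounded_class Y ->
        d_GH X Y = ereal_inf (connecting_lengths (@bounded_class R) X Y)].
Proof.
split; split.
- exact: extended_pseudometric_d_GH.
- by move=> X Y XY; exact: d_GH_intrinsic.
- exact: bounded_class_d_GH_fin.
- exact: extended_pseudometric_d_GH.
- move=> X Y BX BY; apply: d_GH_intrinsic => [Z|].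
    exact: bounded_class_d_GH_closed.
  by rewrite -ge0_fin_numE ?d_GH_ge0// bounded_class_d_GH_fin.
Qed.
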